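(* Let $\partial\in\mathbb{F}_2^{m\times m}$ be the boundary matrix of a simplicial complex $K=\{\sigma_1,\dots,\sigma_m\}$. Then the parallel multi-scale reduction algorithm (described in the context), applied to $\partial$, converges to $\mathrm{low}^*$; that is, after finitely many iterations of its main loop the function $\mathrm{low}$ of the working matrix equals $\mathrm{low}^*$.
   Context: Notation: $[m]=\{1,\dots,m\}$; $\mathbb{F}_2$ is the field with two elements; $\partial_j$ is the $j$-th column and $\partial_{i,\cdot}$ the $i$-th row of $\partial$; for $A\subset[m]$, $\mathrm{low}(A)=\{\mathrm{low}(j):j\in A\}$, with $\mathrm{low}(\emptyset)=\emptyset$. Simplicial complex and boundary matrix: $K=\{\sigma_1,\dots,\sigma_m\}$ is a finite abstract simplicial complex of nonempty simplices, $\dim(\sigma)=|\sigma|-1$, $\dim(K)$ is the maximum dimension of its simplices, $K_d=\{j\in[m]:\dim(\sigma_j)=d\}$, and the simplices are indexed so that the faces of any simplex precede that simplex (compatible ordering). Its boundary matrix $\partial\in\mathbb{F}_2^{m\times m}$ has $\partial_{i,j}=1$ if $\sigma_i$ is a face of $\sigma_j$ of co-dimension $1$, and $\partial_{i,j}=0$ otherwise. For a matrix, $\mathrm{low}(j)$ is the largest row index $i$ of a nonzero entry in column $j$, or $0$ if column $j$ is zero. A matrix is reduced if $\mathrm{low}(j_1)=\mathrm{low}(j_2)>0$ implies $j_1=j_2$. $\mathrm{low}^*$ is the function $\mathrm{low}$ of any reduced matrix obtained from the boundary matrix of $K$ by left-to-right column operations (replacements $\partial_j\leftarrow\partial_j+\partial_\ell$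 with $\ell<j$); it is a known fact that it does not depend on the chosen reduction. Vector $\beta$ (computed from the initial boundary matrix): $\mathrm{left}(i)=\min\{j\in[m]:\partial_{i,j}=1\}$ if $\partial_{i,\cdot}\ne0$, and $\mathrm{left}(i)=0$ otherwise; $\mathcal{L}_j=\{i\in[m]:\mathrm{left}(i)=j\}$; $\beta_j=\max\mathcal{L}_j$ if $\mathcal{L}_j\neq\emptyset$, and $\beta_j=0$ otherwise. The parallel multi-scale reduction algorithm takes $\partial$ and a parameter $\mathrm{MAX\_ITER}\in[m]$. It modifies the working matrix $\partial$ in place; $\mathrm{low}$ always refers to the current working matrix. Phase 0 (initialisation). Compute $\beta$. Set $\mathsf{Pivots}\leftarrow\{j\in[m]:\beta_j=\mathrm{low}(j)>0\}$. For each $j\in\mathsf{Pivots}$ set column $\partial_{\mathrm{low}(j)}\leftarrow0$. Set $\mathrm{iter}\leftarrow0$. Main loop: while $\mathrm{low}\neq\mathrm{low}^*$ or $\mathrm{iter}\le\mathrm{MAX\_ITER}$, do Phase I, then Phase II, then $\mathrm{iter}\leftarrow\mathrm{iter}+1$. Phase I (local injections). For each $d\in\{1,\dots,\dim(K)\}$: set $c\leftarrow0$; then for each $j\in\{\ell\in K_d:\mathrm{low}(\ell)>0\}\setminus\mathsf{Pivots}$, taken in increasing order: if $\mathrm{low}(j)>c$, then (if $\mathrm{low}(j)\notin\mathrm{low}([j-1])$ set $\mathsf{Pivots}\leftarrow\mathsf{Pivots}\cup\{j\}$; otherwise set $c\leftarrow\mathrm{low}(j)$). Phase II (column reduction). For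 each $j_0$ in the set $\mathsf{Pivots}$ as it stands when Phase II begins: let $\mathcal{N}(j_0)=\{\ell\in[m]:\ell>j_0,\ \mathrm{low}(\ell)=\mathrm{low}(j_0)\}$; for each $j\in\mathcal{N}(j_0)$, set $\partial_j\leftarrow\partial_j+\partial_{j_0}$, and then, if $\mathrm{low}(j)=\beta_j$, set $\mathsf{Pivots}\leftarrow\mathsf{Pivots}\cup\{j\}$ and $\partial_{\mathrm{low}(j)}\leftarrow0$ (this last assignment is void if $\mathrm{low}(j)=0$). On exit of the loop the algorithm outputs $\mathrm{low}$. *)

(* Defs.v *)
From mathcomp Require Import all_boot all_order all_fingroup all_algebra.

Set Implicit Arguments.
Unset Strict Implicit.
Unset Printing Implicit Defensive.

Import GRing.Theory.
Local Open Scope ring_scope.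

(* The simplices are indexed by 'I_m, from 0.  The functions low, left and
   beta keep their usual values in {0, ..., m}: index i is reported as i.+1,
   and 0 means "no such index". *)

Section Complex.
Variables (V : finType) (m : nat) (sigma : 'I_m -> {set V}).

Definition simplicial_complex : Prop :=
  [/\ injective sigma,
      forall i, sigma i != set0
    & forall i (t : {set V}),
        t != set0 -> t \subset sigma i -> exists j, sigma j = t].

Definition compatible_ordering : Prop :=
  forall i j : 'I_m, sigma i \proper sigma j -> (i < j)%N.

Definition dim (i : 'I_m) : nat := #|sigma i|.-1.

Definition dimK : nat := (\max_(i < m) dim i)%N.

Definition boundary : 'M['F_2]_m :=
  \matrix_(i, j) ((sigma i \subset sigma j) && (dim j == (dim i).+1))%:R.

End Complex.

Section Reduction.
Variable m : nat.
Implicit Types (A D R : 'M['F_2]_m) (P : {set 'I_m}) (j l : 'I_m).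

Definition low A j : nat := (\max_(i < m | A i j != 0%R) i.+1)%N.

Definition reduced A : Prop :=
  forall j1 j2, low A j1 = low A j2 -> (0 < low A j1)%N -> j1 = j2.

Definition add_col A l j : 'M['F_2]_m :=
  \matrix_(a, b) (if b == j then A a j + A a l else A a b).

(* The column is given by its 1-based index k; nothing happens for k = 0. *)
Definition clear_col A (k : nat) : 'M['F_2]_m :=
  \matrix_(a, b) (if b.+1 == k then 0 else A a b).

Definition left_to_right_op : rel 'M['F_2]_m :=
  fun A B => [exists l : 'I_m, exists j : 'I_m, (l < j)%N && (B == add_col A l j)].

Definition is_reduction D R : Prop := connect left_to_right_op D R /\ reduced R.

Definition left D (i : 'I_m) : nat :=
  if [pick j | D i j != 0] is Some j0
  then ([arg min_(j < j0 | D i j != 0) (j : nat)] : 'I_m).+1 else 0%N.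

Definition beta D j : nat := (\max_(i < m | left D i == j.+1) i.+1)%N.

(* Every ordering of the elements of P is obtained for some s. *)
Definition listing (s : 'S_m) P : seq 'I_m :=
  [seq x <- [seq s i | i <- enum 'I_m] | x \in P].

Definition initial_pivots D : {set 'I_m} :=
  [set j | (beta D j == low D j) && (0 < low D j)%N].

Definition initial_matrix (s : 'S_m) D : 'M['F_2]_m :=
  foldl (fun A j => clear_col A (low A j)) D (listing s (initial_pivots D)).

(* The accumulator holds Pivots and the variable c. *)
Definition phaseI_col A (Pc : {set 'I_m} * nat) j : {set 'I_m} * nat :=
  let: (P, c) := Pc in
  if (c < low A j)%N then
    if [forall l : 'I_m, (l < j)%N ==> (low A l != low A j)]
    then (j |: P, c) else (P, low A j)
  else (P, c).

Definition phaseI_dim (dm : 'I_m -> nat) A P (d : nat) : {set 'I_m} :=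
  (foldl (phaseI_col A) (P, 0%N)
     [seq j <- enum 'I_m | [&& dm j == d, (0 < low A j)%N & j \notin P]]).1.

(* Distinct dimensions act on disjoint sets of columns and the matrix is only
   read, so the order in which the dimensions are treated is immaterial. *)
Definition phaseI (dm : 'I_m -> nat) (dmax : nat) A P : {set 'I_m} :=
  foldl (phaseI_dim dm A) P (iota 1 dmax).

(* b stands for the vector beta of the initial boundary matrix. *)
Definition phaseII_col (b : 'I_m -> nat) j0 (AP : 'M['F_2]_m * {set 'I_m}) j :
    'M['F_2]_m * {set 'I_m} :=
  let: (A, P) := AP in
  let A' := add_col A j0 j in
  if low A' j == b j then (clear_col A' (low A' j), j |: P) else (A', P).

Definition neighbours A j0 : {set 'I_m} :=
  [set l : 'I_m | (j0 < l)%N && (low A l == low A j0)].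

Definition phaseII_pivot (b : 'I_m -> nat) (si : 'I_m -> 'S_m)
    (AP : 'M['F_2]_m * {set 'I_m}) j0 : 'M['F_2]_m * {set 'I_m} :=
  foldl (phaseII_col b j0) AP (listing (si j0) (neighbours AP.1 j0)).

Definition phaseII (b : 'I_m -> nat) (so : 'S_m) (si : 'I_m -> 'S_m)
    A P : 'M['F_2]_m * {set 'I_m} :=
  foldl (phaseII_pivot b si) (A, P) (listing so P).

Record state := State {
  working : 'M['F_2]_m;
  pivots : {set 'I_m};
  iteration : nat }.

End Reduction.

Section Algorithm.
Variables (V : finType) (m : nat) (sigma : 'I_m -> {set V}).
Variables (lowstar : 'I_m -> nat) (max_iter : nat).

(* The order of traversal of the unordered loops is left free: s0 for the
   initialisation, so k for the pivots in iteration k of the main loop, and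
   si k j0 for the neighbours of the pivot j0 in that iteration. *)
Variables (s0 : 'S_m) (so : nat -> 'S_m) (si : nat -> 'I_m -> 'S_m).

Definition start : state m :=
  State (initial_matrix s0 (boundary sigma)) (initial_pivots (boundary sigma)) 0%N.

Definition loop_guard (st : state m) : bool :=
  [exists j, low (working st) j != lowstar j] || (iteration st <= max_iter)%N.

Definition loop_body (st : state m) : state m :=
  let k := iteration st in
  let P := phaseI (dim sigma) (dimK sigma) (working st) (pivots st) in
  let: (A', P') :=
    phaseII (beta (boundary sigma)) (so k) (si k) (working st) P in
  State A' P' k.+1.

(* The state after n turns of the main loop; once the guard fails, the loop is
   exited and the state no longer changes. *)
Definition run (n : nat) : state m :=
  iter n (fun st => if loop_guard st then loop_body st else st) start.

End Algorithm.

(* Main.v *)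
Require Import Defs.
From mathcomp Require Import all_boot all_order all_fingroup all_algebra.

(** Write D for the boundary matrix.  Three facts carry the proof.

    Every operation of the algorithm acts on the working matrix A as a unit
    upper triangular change of columns, so that A = D U throughout
    ([reachable]).  For an addition of a column to a later one this is clear.
    Clearing is the interesting case: when the column i = low(j) is set to 0,
    the column A_j lies in the image of D, hence D A_j = 0 because D D = 0
    ([boundary_mul_boundary]); as the lowest entry of A_j is in row i, this
    equation writes D_i as a sum of earlier columns of D, so setting the i-th
    column to 0 is a legitimate left-to-right reduction
    ([reachable_clear_col]).  The argument applies to any nonzero column A_j, be
    it a final pivot or not.

    If R is reduced and A = R W with W unit upper triangular, then low R <= low A
    ([reduced_low_min]).  Hence all reduced matrices reachable from D have the
    same low, which is low*, and low* bounds from below the low of every working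
    matrix.

    The algorithm never increases low, and it cannot stall: if A is not reduced,
    let j2 be the first column sharing its positive low with an earlier column
    j1.  The positive lows of the columns up to j1 are distinct, so the counter c
    of Phase I is still 0 when j1 is scanned, and j1 is or becomes a pivot
    ([phaseI_finds_pivot]).  In Phase II either something changes before j1 is
    treated, or j1 is treated with j2 among its neighbours; in both cases the sum
    of all lows strictly decreases ([phaseII_pivots_lt]).  So low* is reached
    after a number of turns at most the initial sum, and low cannot leave it
    afterwards, being nonincreasing and at least low*. *)

Set Implicit Arguments.
Unset Strict Implicit.
Unset Printing Implicit Defensive.

Import GRing.Theory.
Local Open Scope ring_scope.

(** * The function low *)

Lemma F2_neq0 (x : 'F_2) : x != 0 -> x = 1.
Proof. by case: x => [[|[|k]] Hk] // _; apply: val_inj. Qed.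

Lemma low_gt m (A : 'M['F_2]_m) (i j : 'I_m) : A i j != 0 -> (i < low A j)%N.
Proof. by move=> Aij; rewrite /low (bigD1 i) //= leq_maxl. Qed.

(** The working form of low, as an upper bound on the support of a column; it
    also covers the convention that low is 0 on zero columns. *)
Lemma low_leP m (A : 'M['F_2]_m) (j : 'I_m) n :
  reflect (forall i : 'I_m, (n <= i)%N -> A i j = 0) (low A j <= n)%N.
Proof.
rewrite /low; apply: (iffP (bigmax_leqP _ _ _)) => [le_n i le_ni | A0 i Aij].
  apply/eqP; apply: contraLR le_ni => Aij.
  by rewrite -ltnNge le_n.
by rewrite ltnNge; apply: contra Aij => /A0 ->.
Qed.

Lemma low_gt0P m (A : 'M['F_2]_m) (j : 'I_m) :
  (0 < low A j)%N -> exists2 i : 'I_m, low A j = i.+1 & A i j = 1.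
Proof.
move=> low_gt0; case lowE: (low A j) low_gt0 => [|n] // _.
have [i /andP[/eqP i_n Aij] | noi] :=
  pickP (fun i : 'I_m => (i == n :> nat) && (A i j != 0)).
  by exists i; [rewrite i_n | apply: F2_neq0].
have : (low A j <= n)%N.
  apply/low_leP=> i; rewrite leq_eqVlt => /orP[/eqP n_i | lt_ni].
    by have := noi i; rewrite n_i eqxx /= => /negbT; rewrite negbK => /eqP.
  by apply/eqP; apply: contraLR lt_ni => /low_gt; rewrite lowE ltnS -leqNgt.
by rewrite lowE ltnn.
Qed.

Lemma eq_low m (A B : 'M['F_2]_m) (j : 'I_m) :
  (forall i, A i j = B i j) -> low A j = low B j.
Proof. by move=> eqAB; apply: eq_bigl => i; rewrite eqAB. Qed.

(** * Unit upper triangular changes of columns *)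

Definition unitriangular m (U : 'M['F_2]_m) : Prop :=
  forall i j : 'I_m, (j <= i)%N -> U i j = (i == j)%:R.

(** A is obtained from D by adding to each column a combination of earlier
    columns.  Unlike a chain of elementary operations, this form makes a clearing
    a single step and allows division (see [reachable_common]). *)
Definition reachable m (D A : 'M['F_2]_m) : Prop :=
  exists2 U, unitriangular U & A = D *m U.

Lemma reachable_refl m (D : 'M['F_2]_m) : reachable D D.
Proof. by exists 1%:M; [move=> i j _; rewrite mxE | rewrite mulmx1]. Qed.

Lemma reachable_add_col m (D A : 'M['F_2]_m) (l j : 'I_m) :
  (l < j)%N -> reachable D A -> reachable D (add_col A l j).
Proof.
move=> lt_lj [U triU ->]; exists (add_col U l j).
  move=> a b le_ba; rewrite mxE; case: eqP le_ba => [-> | _] le_ba.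
    rewrite !triU //; last by rewrite (leq_trans (ltnW lt_lj)).
    by rewrite -[a == l]/(val a == val l) gtn_eqF ?addr0 // (leq_trans lt_lj).
  exact: triU.
apply/matrixP=> a b; rewrite !mxE; case: (b =P j) => [-> | b_j].
  by rewrite -big_split; apply: eq_bigr => k _; rewrite !mxE eqxx mulrDr.
by apply: eq_bigr => k _; rewrite !mxE; case: eqP.
Qed.

(** Clearing lemma.  The column j of A is a cycle since D A = D D U = 0, and its
    last nonzero entry is a 1 in row i, where i.+1 = low A j.  So it can serve as
    the column i of the unitriangular factor, and D sends it to 0. *)
Lemma reachable_clear_col m (D A : 'M['F_2]_m) (j : 'I_m) :
  D *m D = 0 -> reachable D A -> reachable D (clear_col A (low A j)).
Proof.
move=> DD0 reachA; have [U triU defA] := reachA.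
have [low0 | low_gt0] := posnP (low A j).
  suff -> : clear_col A (low A j) = A by [].
  by apply/matrixP=> a b; rewrite mxE low0.
have [i lowE Aij] := low_gt0P low_gt0.
have DA0 : D *m A = 0 by rewrite defA mulmxA DD0 mul0mx.
(* the factor for the cleared matrix is U with its column i replaced by A_j *)
exists (\matrix_(a, b) (if b == i then A a j else U a b)).
  move=> a b le_ba; rewrite mxE; case: eqP le_ba => [-> | _] le_ba; last exact: triU.
  have [-> // | a_i] := eqVneq a i.
  have /low_leP -> // : (low A j <= i.+1)%N by rewrite lowE.
  by rewrite ltn_neqAle eq_sym le_ba andbT.
apply/matrixP=> a b; rewrite !mxE lowE eqSS; case: (b =P i) => [-> | b_i].
  rewrite eqxx; have /matrixP/(_ a j) := DA0; rewrite !mxE => DA0aj.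
  by rewrite -[LHS]DA0aj; apply: eq_bigr => k _; rewrite !mxE eqxx.
rewrite ifN; last by apply/eqP=> /ord_inj.
rewrite defA mxE.
by apply: eq_bigr => k _; rewrite !mxE; case: eqP.
Qed.

Lemma reachable_connect m (D A : 'M['F_2]_m) :
  connect (@left_to_right_op m) D A -> reachable D A.
Proof.
case/connectP=> s path_s ->.
suff gen B : reachable D B -> path (@left_to_right_op m) B s ->
    reachable D (last B s) by apply: gen path_s; apply: reachable_refl.
elim: s {path_s} B => //= C s IHs B reachB.
case/andP=> /existsP[l /existsP[j /andP[lt_lj /eqP defC]]].
by apply: IHs; rewrite defC; apply: reachable_add_col.
Qed.

Lemma unitriangular_unit m (U : 'M['F_2]_m) : unitriangular U -> U \in unitmx.
Proof.
move=> triU; rewrite unitmxE -det_tr det_trig.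
  by rewrite big1 ?unitr1 // => i _; rewrite mxE triU // eqxx.
apply/is_trig_mxP => i j lt_ij.
by rewrite mxE triU ?(ltnW lt_ij) // -[_ == _]/(val j == val i) gtn_eqF.
Qed.

(** Back substitution: row i of W is determined by row i of V and the rows of W
    below i, whence the induction on m - i. *)
Lemma unitriangular_quotient m (U V W : 'M['F_2]_m) :
  unitriangular U -> unitriangular V -> U *m W = V -> unitriangular W.
Proof.
move=> triU triV defV i j; move: {2}(m - i)%N (leqnn (m - i)%N) => n.
elim: n i => [|n IHn] i le_n le_ji.
  by move: le_n; rewrite leqn0 subn_eq0 leqNgt ltn_ord.
have /matrixP/(_ i j) := defV; rewrite mxE (triV i j le_ji) => <-.
rewrite (bigD1 i) //= triU // eqxx mul1r big1 ?addr0 // => k k_i.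
have [lt_ki | le_ik] := ltnP k i.
  by rewrite triU ?(ltnW lt_ki) // eq_sym (negPf k_i) mul0r.
have lt_ik : (i < k)%N by rewrite ltn_neqAle le_ik andbT eq_sym.
rewrite (IHn k) ?(leq_trans le_ji) //.
  by rewrite -[k == j]/(val k == val j) gtn_eqF ?mulr0 // (leq_ltn_trans le_ji).
by rewrite -ltnS; apply: leq_trans le_n; rewrite ltn_sub2l.
Qed.

(** Two matrices reachable from the same D are reachable from each other, since
    unitriangular matrices form a group. *)
Lemma reachable_common m (D A B : 'M['F_2]_m) :
  reachable D A -> reachable D B -> reachable A B.
Proof.
case=> U triU -> [V triV ->]; exists (invmx U *m V).
  by apply: (unitriangular_quotient triU triV); rewrite mulKVmx ?unitriangular_unit.
by rewrite -mulmxA mulKVmx ?unitriangular_unit.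
Qed.

(** The columns of R entering column j of A with nonzero coefficient have
    distinct lows when nonzero, so the largest of these lows is not cancelled; it
    is at least low R j because column j itself enters with coefficient 1. *)
Lemma reduced_low_min m (R A : 'M['F_2]_m) (j : 'I_m) :
  reduced R -> reachable R A -> (low R j <= low A j)%N.
Proof.
move=> redR [W triW defA]; have [-> // | low_gt0] := posnP (low R j).
have Wjj : W j j != 0 by rewrite triW // eqxx oner_eq0.
have [k Wkj kmax'] := @arg_maxnP _ j (fun k => W k j != 0) (low R) Wjj.
have kmax l : W l j != 0 -> (low R l <= low R k)%N := kmax' l.
have le_jk := kmax j Wjj.
have [i lowk Rik] := low_gt0P (leq_trans low_gt0 le_jk).
apply: leq_trans le_jk _; rewrite lowk; apply: low_gt.
rewrite defA mxE (bigD1 k) //= Rik mul1r big1 ?addr0 // => k' k'_k.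
apply/eqP; apply: contraNT k'_k => nz.
have Wk' : W k' j != 0 by apply: contraNneq nz => ->; rewrite mulr0.
have Rk' : R i k' != 0 by apply: contraNneq nz => ->; rewrite mul0r.
have lowk' : low R k' = low R k.
  by apply/eqP; rewrite eqn_leq kmax //= lowk low_gt.
by apply/eqP/redR; rewrite // lowk' lowk.
Qed.

Lemma reduced_low_unique m (D A R : 'M['F_2]_m) :
  reachable D A -> reachable D R -> reduced A -> reduced R -> low A =1 low R.
Proof.
move=> reachA reachR redA redR j; apply/eqP; rewrite eqn_leq.
by rewrite !reduced_low_min //; apply: (@reachable_common _ D).
Qed.

(** * Descent of low under additions and clearings *)

Definition total_low m (A : 'M['F_2]_m) : nat := (\sum_j low A j)%N.

(** What is known of every step of the algorithm, be it an elementary operation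
    or a whole phase.  The dichotomy B = A or strict descent lets progress be
    localised: as long as total_low has not decreased, the working matrix is the
    one at the start of the phase. *)
Definition sound_step m (D A B : 'M['F_2]_m) : Prop :=
  [/\ reachable D A -> reachable D B, forall j, (low B j <= low A j)%N
    & B = A \/ (total_low B < total_low A)%N].

Lemma sound_step_refl m (D A : 'M['F_2]_m) : sound_step D A A.
Proof. by split=> //; left. Qed.

Lemma total_low_le m (A B : 'M['F_2]_m) :
  (forall j, (low B j <= low A j)%N) -> (total_low B <= total_low A)%N.
Proof. by move=> leBA; apply: leq_sum => j _. Qed.

Lemma total_low_lt m (A B : 'M['F_2]_m) (j : 'I_m) :
  (forall k, (low B k <= low A k)%N) -> (low B j < low A j)%N ->
  (total_low B < total_low A)%N.
Proof.
move=> leBA ltBA; rewrite /total_low (bigD1 j) //= [X in (_ < X)%N](bigD1 j) //=.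
by rewrite -addSn leq_add // leq_sum.
Qed.

Lemma sound_step_trans m (D A B C : 'M['F_2]_m) :
  sound_step D A B -> sound_step D B C -> sound_step D A C.
Proof.
case=> rAB leAB dAB [rBC leBC dBC]; split=> [/rAB/rBC // | j |].
  exact: leq_trans (leBC j) (leAB j).
case: dBC => [-> // | ltBC]; right.
exact: leq_trans ltBC (total_low_le leAB).
Qed.

Lemma add_col_neq m (A : 'M['F_2]_m) (l j k : 'I_m) :
  k != j -> low (add_col A l j) k = low A k.
Proof. by move=> k_j; apply: eq_low => i; rewrite mxE (negPf k_j). Qed.

(** Over F_2 the two lowest entries are both 1 and cancel. *)
Lemma add_col_low_lt m (A : 'M['F_2]_m) (l j : 'I_m) :
  low A l = low A j -> (0 < low A j)%N -> (low (add_col A l j) j < low A j)%N.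
Proof.
move=> eq_lj low_gt0; have [i lowj Aij] := low_gt0P low_gt0.
have [i' lowl Ail] := low_gt0P (etrans (congr1 (leq 1) eq_lj) low_gt0).
have eq_i : i' = i by apply: ord_inj; apply: succn_inj; rewrite -lowl -lowj.
rewrite lowj ltnS; apply/low_leP=> k le_ik; rewrite mxE eqxx.
have [-> | k_i] := eqVneq k i; first by rewrite Aij -eq_i Ail; apply: val_inj.
have lt_ik : (i.+1 <= k)%N by rewrite ltn_neqAle le_ik andbT eq_sym.
have /low_leP -> // : (low A j <= i.+1)%N by rewrite lowj.
by have /low_leP -> // : (low A l <= i.+1)%N; rewrite ?addr0 // eq_lj lowj.
Qed.

Lemma add_col_low_le m (A : 'M['F_2]_m) (l j k : 'I_m) :
  low A l = low A j -> (low (add_col A l j) k <= low A k)%N.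
Proof.
move=> eq_lj; have [-> | k_j] := eqVneq k j; last by rewrite add_col_neq.
apply/low_leP=> i le_i; rewrite mxE eqxx.
have /low_leP -> // := leqnn (low A j).
by have /low_leP -> // := leqnn (low A l); rewrite ?addr0 // eq_lj.
Qed.

Lemma sound_add_col m (D A : 'M['F_2]_m) (l j : 'I_m) :
  (l < j)%N -> low A l = low A j -> sound_step D A (add_col A l j).
Proof.
move=> lt_lj eq_lj; split=> [|k|]; first exact: reachable_add_col.
  exact: add_col_low_le.
(* two columns of low 0 are zero columns, and adding them changes nothing *)
have [low0 | low_gt0] := posnP (low A j); [left | right].
  apply/matrixP=> a b; rewrite mxE; case: eqP => // ->.
  have /low_leP -> // : (low A l <= 0)%N by rewrite eq_lj low0.
  by rewrite addr0.
apply: (@total_low_lt _ _ _ j) => [k|]; first exact: add_col_low_le.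
exact: add_col_low_lt.
Qed.

Lemma sound_clear_col m (D A : 'M['F_2]_m) (j : 'I_m) :
  D *m D = 0 -> sound_step D A (clear_col A (low A j)).
Proof.
move=> DD0; have low_le k : (low (clear_col A (low A j)) k <= low A k)%N.
  apply/low_leP=> i le_i; rewrite mxE; case: eqP => // _.
  by have /low_leP -> // := leqnn (low A k).
split=> //; first exact: reachable_clear_col.
have [->|neq] := eqVneq (clear_col A (low A j)) A; [by left | right].
have [low0 | low_gt0] := posnP (low A j).
  by case/eqP: neq; apply/matrixP=> a b; rewrite mxE low0.
have [i lowE _] := low_gt0P low_gt0.
have low_i : low (clear_col A (low A j)) i = 0%N.
  by apply/eqP; rewrite -leqn0; apply/low_leP=> a _; rewrite mxE lowE eqxx.
apply: (@total_low_lt _ _ _ i) => //; rewrite low_i lt0n.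
apply: contraNneq neq => lowi0; apply/eqP/matrixP=> a b.
rewrite mxE lowE eqSS; case: eqP => // /ord_inj ->.
by have /low_leP -> // : (low A i <= 0)%N; rewrite ?lowi0.
Qed.

Lemma sound_initial_matrix m (D : 'M['F_2]_m) (s : 'S_m) :
  D *m D = 0 -> sound_step D D (initial_matrix s D).
Proof.
move=> DD0; rewrite /initial_matrix.
elim: (listing s _) {2 3}D => [|j t IHt] A; first exact: sound_step_refl.
exact: sound_step_trans (sound_clear_col A j DD0) (IHt _).
Qed.

(** * Phase II *)

Lemma sound_phaseII_col m (D : 'M['F_2]_m) b (j0 j : 'I_m) AP :
  D *m D = 0 -> (j0 < j)%N -> low AP.1 j0 = low AP.1 j ->
  sound_step D AP.1 (phaseII_col b j0 AP j).1.
Proof.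
case: AP => A P DD0 lt_j eq_j /=.
have stepA := sound_add_col D lt_j eq_j; case: ifP => _ //=.
exact: sound_step_trans stepA (sound_clear_col _ _ DD0).
Qed.

(** The column cleared while a neighbour of j0 is treated has index below
    low(j0), hence before j0.  So the pivot column j0 and the neighbours still to
    be treated are intact, and the neighbourhood computed at the start of the
    pass stays valid. *)
Lemma phaseII_col_fixed m b (j0 j k : 'I_m) (AP : 'M['F_2]_m * {set 'I_m}) :
  (low AP.1 j0 <= j0)%N -> low AP.1 j0 = low AP.1 j ->
  (j0 <= k)%N -> k != j -> low (phaseII_col b j0 AP j).1 k = low AP.1 k.
Proof.
case: AP => A P /= le_j0 eq_j le_k k_j; case: ifP => _ /=; last exact: add_col_neq.
rewrite -[RHS](add_col_neq A j0 k_j); apply: eq_low => i.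
(* the cleared column is at low - 1 in 0-based indexing, and low A j0 <= j0 <= k *)
rewrite mxE gtn_eqF // ltnS; apply: leq_trans le_k; apply: leq_trans le_j0.
by rewrite eq_j add_col_low_le.
Qed.

Lemma phaseII_col_lt m b (j0 j : 'I_m) (AP : 'M['F_2]_m * {set 'I_m}) :
  low AP.1 j0 = low AP.1 j -> (0 < low AP.1 j)%N ->
  (low (phaseII_col b j0 AP j).1 j < low AP.1 j)%N.
Proof.
case: AP => A P /= eq_j low_gt0; have ltA := add_col_low_lt eq_j low_gt0.
case: ifP => _ //=; apply: leq_ltn_trans ltA.
apply/low_leP=> i le_i; rewrite mxE; case: eqP => // _.
by have /low_leP -> // := leqnn (low (add_col A j0 j) j).
Qed.

Lemma sound_phaseII_neighbours m (D : 'M['F_2]_m) b (j0 : 'I_m) (s : seq 'I_m) AP :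
  D *m D = 0 -> (low AP.1 j0 <= j0)%N -> uniq s ->
  (forall l, l \in s -> (j0 < l)%N /\ low AP.1 j0 = low AP.1 l) ->
  sound_step D AP.1 (foldl (phaseII_col b j0) AP s).1.
Proof.
move=> DD0; elim: s AP => [|j s IHs] AP le_j0; first by move=> *; apply: sound_step_refl.
move=> /= /andP[j_s uniq_s] nbr.
have [lt_j eq_j] := nbr j (mem_head j s).
apply: sound_step_trans (sound_phaseII_col b DD0 lt_j eq_j) (IHs _ _ uniq_s _).
  by rewrite phaseII_col_fixed // -[_ == _]/(val j0 == val j) ltn_eqF.
move=> l l_s; have [|lt_l eq_l] := nbr l; first by rewrite inE l_s orbT.
have l_j : l != j by apply: contraNneq j_s => <-.
split=> //; rewrite !phaseII_col_fixed ?(ltnW lt_l) //.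
by rewrite -[_ == _]/(val j0 == val j) ltn_eqF.
Qed.

Lemma mem_listing m (s : 'S_m) (P : {set 'I_m}) : listing s P =i P.
Proof.
move=> x; rewrite mem_filter andb_idr // => _.
by apply/mapP; exists ((s^-1)%g x); rewrite ?mem_enum ?permKV.
Qed.

Lemma listing_uniq m (s : 'S_m) (P : {set 'I_m}) : uniq (listing s P).
Proof. by rewrite filter_uniq // map_inj_uniq ?enum_uniq //; apply: perm_inj. Qed.

Lemma neighboursP m (A : 'M['F_2]_m) (s : 'S_m) (j0 l : 'I_m) :
  l \in listing s (neighbours A j0) -> (j0 < l)%N /\ low A j0 = low A l.
Proof. by rewrite mem_listing inE => /andP[-> /eqP->]. Qed.

Lemma sound_phaseII_pivot m (D : 'M['F_2]_m) b si (j0 : 'I_m) AP :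
  D *m D = 0 -> (low AP.1 j0 <= j0)%N ->
  sound_step D AP.1 (phaseII_pivot b si AP j0).1.
Proof.
move=> DD0 le_j0; apply: sound_phaseII_neighbours => //.
  exact: listing_uniq.
exact: neighboursP.
Qed.

(** The first neighbour treated already loses its lowest entry, and the later ones
    do not raise any low. *)
Lemma phaseII_pivot_lt m (D : 'M['F_2]_m) b si (j0 l : 'I_m) AP :
  D *m D = 0 -> (low AP.1 j0 <= j0)%N -> (0 < low AP.1 j0)%N ->
  l \in neighbours AP.1 j0 ->
  (total_low (phaseII_pivot b si AP j0).1 < total_low AP.1)%N.
Proof.
move=> DD0 le_j0 low_gt0; rewrite /phaseII_pivot -(mem_listing (si j0)).
have := @neighboursP _ AP.1 (si j0) j0.
have := listing_uniq (si j0) (neighbours AP.1 j0).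
case: (listing _ _) => [|j s] //= /andP[j_s uniq_s] nbr _.
have [lt_j eq_j] := nbr j (mem_head j s).
have [_ le1 _] := sound_phaseII_col b DD0 lt_j eq_j.
have lt1 : (total_low (phaseII_col b j0 AP j).1 < total_low AP.1)%N.
  by apply: (@total_low_lt _ _ _ j) => //; apply: phaseII_col_lt; rewrite -?eq_j.
have j0_j : j0 != j by rewrite -[_ == _]/(val j0 == val j) ltn_eqF.
have [||_ le2 _] :=
  @sound_phaseII_neighbours _ D b j0 s (phaseII_col b j0 AP j) DD0 _ uniq_s.
- by rewrite phaseII_col_fixed.
- move=> k k_s; have [|lt_k eq_k] := nbr k; first by rewrite inE k_s orbT.
  have k_j : k != j by apply: contraNneq j_s => <-.
  by split=> //; rewrite !phaseII_col_fixed ?(ltnW lt_k).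
by apply: leq_ltn_trans lt1; apply: total_low_le.
Qed.

Lemma sound_phaseII_pivots m (D : 'M['F_2]_m) b si (s : seq 'I_m) AP :
  D *m D = 0 -> (forall j : 'I_m, (low AP.1 j <= j)%N) ->
  sound_step D AP.1 (foldl (phaseII_pivot b si) AP s).1.
Proof.
move=> DD0; elim: s AP => [|j s IHs] AP triA; first exact: sound_step_refl.
have step := sound_phaseII_pivot b si DD0 (triA j).
apply: (sound_step_trans step (IHs _ _)) => k.
by have [_ leA _] := step; apply: leq_trans (leA k) (triA k).
Qed.

(** Either a pivot listed before j0 already lowers the sum, or the matrix is
    unchanged and l is still a neighbour of j0 when j0 is reached. *)
Lemma phaseII_pivots_lt m (D : 'M['F_2]_m) b si (s : seq 'I_m) AP (j0 l : 'I_m) :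
  D *m D = 0 -> (forall j : 'I_m, (low AP.1 j <= j)%N) ->
  j0 \in s -> (0 < low AP.1 j0)%N -> l \in neighbours AP.1 j0 ->
  (total_low (foldl (phaseII_pivot b si) AP s).1 < total_low AP.1)%N.
Proof.
move=> DD0; elim: s AP => [|j s IHs] AP triA //= j0_s low_gt0 nbr_l.
have [_ le1 eq_or_lt] := sound_phaseII_pivot b si DD0 (triA j).
have tri1 k : (low (phaseII_pivot b si AP j).1 k <= k)%N.
  exact: leq_trans (le1 k) (triA k).
have [_ /total_low_le le2 _] := sound_phaseII_pivots b si s DD0 tri1.
case: eq_or_lt => [same | lt1]; last exact: leq_ltn_trans lt1.
case/predU1P: j0_s => [defj | j0_s].
  apply: leq_ltn_trans le2 _; rewrite -defj.
  exact: (phaseII_pivot_lt b si DD0 (triA j0) low_gt0 nbr_l).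
by rewrite -same; apply: IHs; rewrite ?same.
Qed.

(** * Phase I *)

Lemma phaseI_cols_sub m (A : 'M['F_2]_m) (s : seq 'I_m) (Pc : {set 'I_m} * nat) :
  Pc.1 \subset (foldl (phaseI_col A) Pc s).1.
Proof.
elim: s Pc => [|j s IHs] [P c] //=; apply: subset_trans (IHs _).
by do 2?case: ifP => //= _; apply: subsetUr.
Qed.

Lemma phaseI_dims_sub m dm (A : 'M['F_2]_m) (P : {set 'I_m}) (s : seq nat) :
  P \subset foldl (phaseI_dim dm A) P s.
Proof.
elim: s P => //= d s IHs P; apply: subset_trans (IHs _).
exact: (phaseI_cols_sub _ _ (P, 0%N)).
Qed.

(** The counter c starts at 0 and rises only at a column whose low occurred
    earlier; by hypothesis there is none up to j, so every scanned column up to j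
    becomes a pivot. *)
Lemma phaseI_cols_mem m (A : 'M['F_2]_m) (j : 'I_m) (s : seq 'I_m) (P : {set 'I_m}) :
  sorted ltn (map val s) -> j \in s ->
  (forall k, k \in s -> (0 < low A k)%N) ->
  (forall k l : 'I_m, (k <= j)%N -> (l < k)%N -> (0 < low A k)%N ->
     low A l != low A k) ->
  j \in (foldl (phaseI_col A) (P, 0%N) s).1.
Proof.
move=> + + + fresh; elim: s P => //= k s IHs P sorted_s j_s low_gt0.
have k_gt0 := low_gt0 k (mem_head k s).
have le_kj : (k <= j)%N.
  case/predU1P: j_s => [-> // | j_s]; apply: ltnW.
  have /allP := order_path_min ltn_trans sorted_s.
  by apply; apply: map_f.
rewrite k_gt0 ifT; last by apply/forallP=> l; apply/implyP=> lt_lk; apply: fresh.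
case/predU1P: j_s => [-> | j_s].
  by apply: (subsetP (phaseI_cols_sub _ _ _)); rewrite /= setU11.
apply: IHs => // [|l l_s]; first exact: path_sorted sorted_s.
by apply: low_gt0; rewrite inE l_s orbT.
Qed.

Lemma phaseI_dim_mem m dm (A : 'M['F_2]_m) (P : {set 'I_m}) (j : 'I_m) :
  (0 < low A j)%N ->
  (forall k l : 'I_m, (k <= j)%N -> (l < k)%N -> (0 < low A k)%N ->
     low A l != low A k) ->
  j \in phaseI_dim dm A P (dm j).
Proof.
move=> low_gt0 fresh; have [j_P | j_P] := boolP (j \in P).
  exact: (subsetP (phaseI_cols_sub _ _ (P, 0%N))).
apply: phaseI_cols_mem => // [||k].
- apply: (subseq_sorted ltn_trans _ (iota_ltn_sorted 0 m)).
  by rewrite -val_enum_ord; apply: map_subseq; apply: filter_subseq.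
- by rewrite mem_filter eqxx low_gt0 j_P mem_enum.
- by rewrite mem_filter => /andP[/and3P[]].
Qed.

Lemma phaseI_mem m dm dmax (A : 'M['F_2]_m) (P : {set 'I_m}) (j : 'I_m) :
  (0 < dm j <= dmax)%N -> (0 < low A j)%N ->
  (forall k l : 'I_m, (k <= j)%N -> (l < k)%N -> (0 < low A k)%N ->
     low A l != low A k) ->
  j \in phaseI dm dmax A P.
Proof.
move=> dm_j low_gt0 fresh.
have : dm j \in iota 1 dmax by rewrite mem_iota add1n ltnS.
rewrite /phaseI; case/splitPr => s1 s2; rewrite foldl_cat /=.
by apply: (subsetP (phaseI_dims_sub _ _ _ _)); apply: phaseI_dim_mem.
Qed.

(** Minimality of the colliding column j2 makes all lows before it distinct; the
    earlier column j1 it collides with is then a pivot that has j2 as a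
    neighbour. *)
Lemma phaseI_finds_pivot m dm dmax (A : 'M['F_2]_m) (P : {set 'I_m}) :
  (forall j : 'I_m, (0 < low A j)%N -> (0 < dm j <= dmax)%N) ->
  reduced A \/ exists j0, exists l : 'I_m,
    [/\ j0 \in phaseI dm dmax A P, (0 < low A j0)%N & l \in neighbours A j0].
Proof.
move=> dm_low.
pose collides (k : 'I_m) :=
  [exists l : 'I_m, [&& (l < k)%N, low A l == low A k & (0 < low A k)%N]].
have [k0 coll_k0 | nocoll] := pickP collides; [right | left].
  have [j2 /existsP[j1 /and3P[lt_12 /eqP eq_12 low_gt0]] j2min] :=
    @arg_minnP _ k0 collides val coll_k0.
  exists j1, j2; rewrite eq_12 low_gt0 inE lt_12 eq_12 eqxx; split=> //.
  rewrite -eq_12 in low_gt0; apply: phaseI_mem (dm_low _ low_gt0) low_gt0 _.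
  move=> k l le_k1 lt_lk k_gt0; apply/negP=> eq_lk.
  have: (j2 <= k)%N by apply: j2min; apply/existsP; exists l; apply/and3P.
  by rewrite leqNgt (leq_ltn_trans le_k1).
have distinct (j1 j2 : 'I_m) : (j1 < j2)%N -> low A j1 = low A j2 -> low A j2 = 0%N.
  move=> lt_12 eq_12; apply/eqP; rewrite -leqn0 leqNgt; apply/negP=> low_gt0.
  by have /existsP[] := nocoll j2; exists j1; rewrite lt_12 eq_12 eqxx.
move=> j1 j2 eq_12 low_gt0; apply: ord_inj.
have [lt_12 | lt_21 | //] := ltngtP j1 j2.
  by rewrite eq_12 (distinct _ _ lt_12) in low_gt0.
by rewrite (distinct _ _ lt_21) in low_gt0.
Qed.

(** * The boundary matrix *)

(** A codimension 2 face of a simplex lies in exactly two intermediate faces, and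
    2 = 0 in F_2. *)
Lemma boundary_mul_boundary (V : finType) (m : nat) (sigma : 'I_m -> {set V}) :
  simplicial_complex sigma -> boundary sigma *m boundary sigma = 0.
Proof.
case=> sigma_inj sigma_neq0 sigma_face.
have cardE i : #|sigma i| = (Defs.dim sigma i).+1.
  by rewrite /Defs.dim prednK // card_gt0.
apply/matrixP=> i k; rewrite !mxE.
pose J := [set j | [&& sigma i \subset sigma j, sigma j \subset sigma k,
                     Defs.dim sigma j == (Defs.dim sigma i).+1
                     & Defs.dim sigma k == (Defs.dim sigma j).+1]].
transitivity (#|J|%:R : 'F_2).
  rewrite -sum1_card natr_sum [RHS]big_mkcond; apply: eq_bigr => j _.
  by rewrite !mxE inE -natrM mulnb andbACA -andbA; case: ifP => // ->.
have [-> | [j0 j0J]] := set_0Vmem J; first by rewrite cards0.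
have [s_ik cardk] : sigma i \subset sigma k /\ #|sigma k| = #|sigma i|.+2.
  move: j0J; rewrite inE => /and4P[s1 s2 /eqP d1 /eqP d2].
  by split; [apply: subset_trans s2 | rewrite !cardE d2 d1].
(* an intermediate face adds to sigma i one of the two other vertices of sigma k *)
suff imJ : sigma @: J = (fun v => v |: sigma i) @: (sigma k :\: sigma i).
  rewrite -(card_imset _ sigma_inj) imJ card_in_imset.
    by rewrite cardsD (setIidPr s_ik) cardk 2?subSn ?subnn //; apply: val_inj.
  move=> v w; rewrite !inE => /andP[v_i _] _ /setP/(_ v).
  by rewrite !inE eqxx (negPf v_i) !orbF => /esym/eqP.
apply/setP=> t; apply/imsetP/imsetP => [[j] | [v]].
  rewrite inE => /and4P[s1 s2 /eqP d1 _] ->.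
  have /cards1P[v defv] : #|sigma j :\: sigma i| == 1%N.
    by rewrite cardsD (setIidPr s1) !cardE d1 subSnn.
  have /setDP[v_j v_i] : v \in sigma j :\: sigma i by rewrite defv set11.
  exists v; first by rewrite inE v_i (subsetP s2).
  by rewrite -{1}(setID (sigma j) (sigma i)) (setIidPr s1) defv setUC.
rewrite inE => /andP[v_i v_k] ->.
have v_sub : v |: sigma i \subset sigma k by rewrite subUset sub1set v_k.
have [|j defj] := sigma_face k _ _ v_sub.
  by apply/set0Pn; exists v; rewrite setU11.
have cardj : #|sigma j| = #|sigma i|.+1 by rewrite defj cardsU1 v_i.
have dimj : Defs.dim sigma j = (Defs.dim sigma i).+1.
  by apply: succn_inj; rewrite -!cardE.
have dimk : Defs.dim sigma k = (Defs.dim sigma j).+1.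
  by apply: succn_inj; rewrite -!cardE cardk cardj.
by exists j => //; rewrite inE defj v_sub subsetUr dimk dimj !eqxx.
Qed.

(** A facet has a smaller 0-based index than its simplex, so its 1-based index,
    the one reported by low, is at most the 0-based index j. *)
Lemma boundary_low_le (V : finType) (m : nat) (sigma : 'I_m -> {set V}) (j : 'I_m) :
  compatible_ordering sigma -> (low (boundary sigma) j <= j)%N.
Proof.
move=> Kordered.
apply/low_leP=> i; rewrite mxE leqNgt; case: andP => // -[s_ij /eqP dimj] /negP[].
apply: Kordered; rewrite properEneq s_ij andbT; apply/eqP=> eq_ij.
by move: dimj; rewrite /Defs.dim eq_ij => /n_Sn.
Qed.

(** Phase I scans only the dimensions from 1 to dim K; this and the descent of low
    show that it overlooks no nonzero column. *)
Lemma boundary_low_dim (V : finType) (m : nat) (sigma : 'I_m -> {set V}) (j : 'I_m) :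
  (0 < low (boundary sigma) j)%N -> (0 < Defs.dim sigma j <= dimK sigma)%N.
Proof.
move=> /low_gt0P[i _]; rewrite mxE.
case: andP => [[_ /eqP dimj] _ | _ /eqP]; last by rewrite eq_sym oner_eq0.
by apply/andP; split; [rewrite dimj | apply: (@leq_bigmax _ (Defs.dim sigma))].
Qed.

(** * Convergence *)

(** The pivot found by Phase I has a neighbour, on which Phase II then acts. *)
Lemma loop_body_step (V : finType) (m : nat) (sigma : 'I_m -> {set V})
    (so : nat -> 'S_m) (si : nat -> 'I_m -> 'S_m) (st : state m) :
  let D := boundary sigma in
  let A := working st in
  let B := working (loop_body sigma so si st) in
  simplicial_complex sigma -> compatible_ordering sigma ->
  (forall j, (low A j <= low D j)%N) ->
  sound_step D A B /\ (reduced A \/ (total_low B < total_low A)%N).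
Proof.
case: st => A P n D A0 B Kcomplex Kordered.
rewrite {}/A0 /= => leD.
have DD0 := boundary_mul_boundary Kcomplex.
have triA j : (low A j <= j)%N := leq_trans (leD j) (boundary_low_le j Kordered).
pose P1 := phaseI (Defs.dim sigma) (dimK sigma) A P.
have -> : B = (phaseII (beta D) (so n) (si n) A P1).1.
  by rewrite /B /loop_body /= -/P1; case: phaseII.
split; first exact: (@sound_phaseII_pivots _ D (beta D) (si n) _ (A, P1)).
have [|redA | [j0 [l [j0_P low_gt0 nbr_l]]]] :=
    @phaseI_finds_pivot _ (Defs.dim sigma) (dimK sigma) A P; [|by left|right].
  by move=> j low_gt0; apply: boundary_low_dim; apply: leq_trans (leD j).
apply: (@phaseII_pivots_lt _ D _ _ _ (A, P1) j0 l) => //.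
by rewrite mem_listing.
Qed.

Theorem theorem8 (V : finType) (m : nat) (sigma : 'I_m -> {set V})
    (Kcomplex : simplicial_complex sigma)
    (Kordered : compatible_ordering sigma)
    (R : 'M['F_2]_m) (Rred : is_reduction (boundary sigma) R)
    (max_iter : nat) (max_iterP : (1 <= max_iter <= m)%N)
    (s0 : 'S_m) (so : nat -> 'S_m) (si : nat -> 'I_m -> 'S_m) :
  exists N : nat, forall n : nat, (N <= n)%N ->
    low (working (run sigma (low R) max_iter s0 so si n)) =1 low R.
Proof.
set D := boundary sigma in Rred *.
have [/reachable_connect reachR redR] := Rred.
pose A n := working (run sigma (low R) max_iter s0 so si n).
have stepA n : (forall j, (low (A n) j <= low D j)%N) ->
    sound_step D (A n) (A n.+1) /\
    [\/ reduced (A n), low (A n) =1 low R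
      | (total_low (A n.+1) < total_low (A n))%N].
  rewrite /A /run iterS; move: (iter n _ _) => st leD.
  rewrite /loop_guard; case: existsP => [_ | eqR] /=.
    have [step [redA | lt_A]] := loop_body_step so si Kcomplex Kordered leD.
      by split; last exact: Or31.
    by split; last exact: Or33.
  have eq_low : low (working st) =1 low R.
    by move=> j; apply/eqP/negPn/negP=> neq; apply: eqR; exists j.
  case: ifP => _; last by split; [apply: sound_step_refl | apply: Or32].
  by have [? _] := loop_body_step so si Kcomplex Kordered leD; split; last exact: Or32.
have invA n : reachable D (A n) /\ (forall j, (low (A n) j <= low D j)%N).
  elim: n => [|n [reachA leD]].
    have [reachD leD _] := sound_initial_matrix s0 (boundary_mul_boundary Kcomplex).
    by split=> //; apply/reachD/reachable_refl.
  have [[reachS leS _] _] := stepA n leD.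
  by split=> [|j]; [apply: reachS | apply: leq_trans (leS j) (leD j)].
have stable n : low (A n) =1 low R -> low (A n.+1) =1 low R.
  move=> eqR j; have [[_ leS _] _] := stepA n (invA n).2.
  apply/eqP; rewrite eqn_leq -{1}eqR leS /=.
  by apply: reduced_low_min redR _; apply: reachable_common reachR (invA n.+1).1.
(* each turn that starts away from low R costs at least one unit of total_low *)
have budget n : low (A n) =1 low R \/ (total_low (A n) + n <= total_low (A 0%N))%N.
  elim: n => [|n [eqR | le_n]]; first by rewrite addn0; right.
    by left; apply: stable.
  have [reachA leD] := invA n.
  have [_ [redA | eqR | lt_n]] := stepA n leD.
  - by left; apply/stable/(@reduced_low_unique _ D).
  - by left; apply: stable.
  by right; apply: leq_trans le_n; rewrite addnS -addSn leq_add2r.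
exists (total_low (A 0%N)).+1 => n lt_n.
have [// | le_n] := budget n.
by have := leq_trans (leq_addl _ _) le_n; rewrite leqNgt lt_n.
Qed.
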